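(* Let $\mathbb{K}$ be a field and let $\mathcal{F}=\{f_1,\dots,f_k\}$ be a finite family of polynomials in $\mathbb{K}[x_1,\dots,x_n]$. Then $$\mathrm{Lfd}(\mathcal{F})\leq \max\{\mathrm{d}_{\mathrm{reg}}(\mathcal{F})+1,\deg(f_1),\dots,\deg(f_k)\}.$$
   Context: $\mathbb{K}$ is an arbitrary field (not necessarily finite), and $(\mathcal{F})$ denotes the ideal of $\mathbb{K}[x_1,\dots,x_n]$ generated by $\mathcal{F}$. For a nonzero polynomial $p$, $p^{\mathrm{top}}$ is the homogeneous part of largest degree of $p$. For an ideal $\mathcal{I}$, $\mathcal{I}_d$ is the set of homogeneous polynomials of degree $d$ in $\mathcal{I}$ (including $0$). Degree of regularity: $\mathrm{d}_{\mathrm{reg}}(\mathcal{F})$ is the smallest integer $d\ge 0$ for which $(\mathcal{F}^{\mathrm{top}})_d=(\mathbb{K}[x_1,\dots,x_n])_d$, where $\mathcal{F}^{\mathrm{top}}=\{f_1^{\mathrm{top}},\dots,f_k^{\mathrm{top}}\}$ and $(\mathcal{F}^{\mathrm{top}})$ is the ideal it generates; if no such $d$ exists, $\mathrm{d}_{\mathrm{reg}}(\mathcal{F})=+\infty$. For an integer $d$, $V_{\mathcal{F},d}$ is the smallest $\mathbb{K}$-linear subspace of $\mathbb{K}[x_1,\dots,x_n]$ (with respect to inclusion) such that (i) $\{f\in\mathcal{F}:\deg(f)\leq d\}\subseteq V_{\mathcal{F},d}$, and (ii) for every monomial $m$ and every $f\in V_{\mathcal{F},d}$ with $\deg(mf)\leq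 d$, one has $mf\in V_{\mathcal{F},d}$. One sets $V_{\mathcal{F},+\infty}=(\mathcal{F})$. Last fall degree: $\mathrm{Lfd}(\mathcal{F})$ is the minimal $d\in\mathbb{Z}_{>0}\cup\{+\infty\}$ such that $f\in V_{\mathcal{F},\max\{d,\deg(f)\}}$ for all $f\in(\mathcal{F})$. *)

(* Defs.v *)
From mathcomp Require Import all_boot all_order all_algebra.
(* [mpoly] has to be loaded before the classical/reals layers: in the other
   order its notations are rejected by the parser. *)
From mathcomp Require Import mpoly.
From mathcomp Require Import boolp classical_sets constructive_ereal.

Set Implicit Arguments.
Unset Strict Implicit.
Unset Printing Implicit Defensive.

Import Order.TTheory GRing.Theory Num.Theory.

Local Open Scope classical_set_scope.
Local Open Scope ring_scope.

(* Degrees live in [\bar int]: +oo is a possible value of [dreg] and [Lfd], and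
   the zero polynomial has degree -oo. *)
Definition deg (K : fieldType) (n : nat) (p : {mpoly K[n]}) : \bar int :=
  if p == 0 then -oo%E else ((msize p).-1%:Z)%:E.

(* For p = 0 this is 0. *)
Definition top_form (K : fieldType) (n : nat) (p : {mpoly K[n]}) :
  {mpoly K[n]} := pihomog mdeg (msize p).-1 p.

Definition is_subspace (K : fieldType) (n : nat) (A : set {mpoly K[n]}) :
  Prop :=
  A 0 /\ forall (c : K) (p q : {mpoly K[n]}), A p -> A q -> A (c *: p + q).

Definition is_ideal (K : fieldType) (n : nat) (A : set {mpoly K[n]}) : Prop :=
  [/\ A 0, forall p q, A p -> A q -> A (p + q)
         & forall h p, A p -> A (h * p)].

Definition ideal_gen (K : fieldType) (n : nat) (G : set {mpoly K[n]}) :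
  set {mpoly K[n]} := smallest (@is_ideal K n) G.

Definition homog_part (K : fieldType) (n : nat) (A : set {mpoly K[n]})
  (d : nat) : set {mpoly K[n]} := A `&` [set p | p \is d.-homog].

(* The least natural number satisfying P, and +oo if there is none. *)
Definition min_or_pinfty (P : nat -> Prop) : \bar int :=
  if pselect (exists d, `[< P d >]) is left exP
  then ((ex_minn exP)%:Z)%:E else +oo%E.

Definition dreg (K : fieldType) (n : nat) (F : seq {mpoly K[n]}) : \bar int :=
  min_or_pinfty (fun d =>
    homog_part (ideal_gen [set` [seq top_form f | f <- F]]) d
    = homog_part [set: {mpoly K[n]}] d).

Definition monomial_closed_upto (K : fieldType) (n : nat) (d : \bar int)
    (A : set {mpoly K[n]}) : Prop :=
  forall (m : 'X_{1..n}) (f : {mpoly K[n]}),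
    A f -> (deg ('X_[m] * f) <= d)%E -> A ('X_[m] * f).

Definition Vspace (K : fieldType) (n : nat) (F : seq {mpoly K[n]})
    (d : \bar int) : set {mpoly K[n]} :=
  if d == +oo%E then ideal_gen [set` F]
  else smallest (fun A => is_subspace A /\ monomial_closed_upto d A)
         [set f | f \in F /\ (deg f <= d)%E].

Definition lfd_bound (K : fieldType) (n : nat) (F : seq {mpoly K[n]})
    (d : \bar int) : Prop :=
  (0 < d)%E /\
  forall f, ideal_gen [set` F] f -> Vspace F (maxe d (deg f)) f.

(* It is enough to search the finite bounds, since +oo is always a bound;
   see [Lfd_bound] and [Lfd_min]. *)
Definition Lfd (K : fieldType) (n : nat) (F : seq {mpoly K[n]}) : \bar int :=
  min_or_pinfty (fun d => lfd_bound F (d%:Z)%:E).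

Lemma lfd_bound_pinfty (K : fieldType) (n : nat) (F : seq {mpoly K[n]}) :
  lfd_bound F +oo%E.
Proof. by split=> // f If; rewrite maxye /Vspace eqxx. Qed.

Lemma Lfd_bound (K : fieldType) (n : nat) (F : seq {mpoly K[n]}) :
  lfd_bound F (Lfd F).
Proof.
rewrite /Lfd /min_or_pinfty; case: pselect => [exP | _].
  by case: ex_minnP => d /asboolP.
exact: lfd_bound_pinfty.
Qed.

Lemma Lfd_min (K : fieldType) (n : nat) (F : seq {mpoly K[n]}) (d : \bar int) :
  lfd_bound F d -> (Lfd F <= d)%E.
Proof.
case: d => [[d|d]||] Fd; last 1 first.
- by case: Fd.
- rewrite /Lfd /min_or_pinfty; case: pselect => [exP | nexP].
    by case: ex_minnP => e _ e_min; rewrite lee_fin lez_nat e_min //; apply/asboolP.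
  by case: nexP; exists d; apply/asboolP.
- by case: Fd.
- exact: leey.
Qed.

(* Main.v *)
Require Import Defs.
From mathcomp Require Import all_boot all_order all_algebra.
From mathcomp Require Import ssrcomplements mpoly.
From mathcomp Require Import ring.
From mathcomp Require Import boolp classical_sets constructive_ereal.

Local Open Scope ring_scope.

Set Implicit Arguments.
Unset Strict Implicit.
Unset Printing Implicit Defensive.

Import Order.TTheory GRing.Theory Num.Theory.

(** Write r for the degree of regularity, which may be supposed finite, and let
    e > r be an integer that bounds the degrees of the generators. The theorem
    follows once V_{F,e} contains every f in (F) of degree at most e
    ([ideal_gen_Vspace]): apply this with e the maximum of the asserted bound
    and deg f.

    By definition of r, every form of degree r is a combination of the top forms
    of F. Replacing the top forms by the generators themselves shows that every
    polynomial of degree at most r is congruent, modulo V = V_{F,e}, to one of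
    degree less than r ([regular_reduction]).

    The heart of the matter, [ideal_agreeing], is that V agrees in degree at most
    e with an ideal I. This holds for any subspace V that has the reduction
    property above and is closed under multiplication by monomials as long as
    the degree stays at most e. Let S be
    the space of polynomials of degree less than r. Multiplication by a variable
    followed by reduction modulo V makes the quotient of S by its intersection
    with V into a module over the polynomial ring. The variables act by
    commuting operators because a product of two variables with an element of S
    has degree at most r + 1 <= e: this is where the summand 1 in the bound is
    needed. Then I is the annihilator of the class of 1. In degree at most e,
    the product p * 1 in this module is the class of p modulo V, so I and V
    agree there. Since V contains F, so does I, hence I contains (F), and an f in
    (F) of degree at most e lies in V. *)

(** * Degrees and homogeneous parts *)

Lemma deg_leE (K : fieldType) (n : nat) (p : {mpoly K[n]}) (d : nat) :
  (deg p <= (d%:Z)%:E)%E = (msize p <= d.+1)%N.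
Proof.
rewrite /deg; have [->|p0] := eqVneq p 0; first by rewrite leNye mmeasure0.
by rewrite lee_fin lez_nat (mpolySpred _ p0).
Qed.

Lemma msize_mulXi (K : fieldType) (n : nat) (i : 'I_n) (p : {mpoly K[n]}) :
  (msize ('X_i * p) <= (msize p).+1)%N.
Proof.
have [->|p0] := eqVneq p 0; first by rewrite mulr0 mmeasure0.
have X0 : 'X_i != 0 :> {mpoly K[n]} by rewrite -msize_poly_eq0 msizeX.
by rewrite msizeM // msizeX mdeg1.
Qed.

Lemma msize_leP (K : fieldType) (n : nat) (p : {mpoly K[n]}) (k : nat) :
  {in msupp p, forall m, (mdeg m < k)%N} -> (msize p <= k)%N.
Proof. by move=> pk; rewrite msizeE; apply/bigmax_leqP_seq => m /pk. Qed.

(** Together with [msizeB_leq], allows bounding a sum by bounding each term, in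
    place of the maximum that [msizeD_le] gives. *)
Lemma msizeD_leq (K : fieldType) (n k : nat) (p q : {mpoly K[n]}) :
  (msize p <= k)%N -> (msize q <= k)%N -> (msize (p + q) <= k)%N.
Proof. by move=> pk qk; rewrite (leq_trans (msizeD_le _ _)) // geq_max pk. Qed.

Lemma msizeB_leq (K : fieldType) (n k : nat) (p q : {mpoly K[n]}) :
  (msize p <= k)%N -> (msize q <= k)%N -> (msize (p - q) <= k)%N.
Proof. by move=> pk qk; rewrite msizeD_leq ?msizeN. Qed.

Lemma msize_pihomog (K : fieldType) (n d : nat) (p : {mpoly K[n]}) :
  (msize (pihomog mdeg d p) <= d.+1)%N.
Proof.
by apply: msize_leP; have /dhomogP h := pihomogP mdeg d p => m /h /= ->.
Qed.

Lemma msize_pihomog0 (K : fieldType) (n d : nat) (p : {mpoly K[n]}) :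
  (msize p <= d.+1)%N -> pihomog mdeg d p = 0 -> (msize p <= d)%N.
Proof.
move=> pd p0; rewrite (pihomog_partitionE pd) big_ord_recr /= p0 addr0.
apply: (big_ind (fun q => msize q <= d)%N) => [||i _]; first by rewrite mmeasure0.
  exact: msizeD_leq.
by rewrite (leq_trans (msize_pihomog _ _)).
Qed.

Lemma pihomog_mulXi (K : fieldType) (n d : nat) (i : 'I_n) (p : {mpoly K[n]}) :
  pihomog mdeg d.+1 ('X_i * p) = 'X_i * pihomog mdeg d p.
Proof.
rewrite [p in LHS]mpolyE mulr_sumr raddf_sum /= pihomogE mulr_sumr [RHS]big_mkcond /=.
apply: eq_bigr => m _; rewrite -!scalerAr -mpolyXD linearZ /= pihomogX /= mdegD mdeg1.
by rewrite add1n eqSS; case: ifP => // _; rewrite scaler0.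
Qed.

Lemma pihomog0_mulXi (K : fieldType) (n : nat) (i : 'I_n) (p : {mpoly K[n]}) :
  pihomog mdeg 0 ('X_i * p) = 0.
Proof.
rewrite [p]mpolyE mulr_sumr raddf_sum /= big1 // => m _.
by rewrite -scalerAr -mpolyXD linearZ /= pihomogX /= mdegD mdeg1 scaler0.
Qed.

(** * Subspaces and ideals *)

Lemma subspaceD (K : fieldType) (n : nat) (A : set {mpoly K[n]}) p q :
  is_subspace A -> A p -> A q -> A (p + q).
Proof. by move=> [_ AP] Ap Aq; rewrite -(scale1r p); apply: AP. Qed.

Lemma subspaceZ (K : fieldType) (n : nat) (A : set {mpoly K[n]}) (c : K) p :
  is_subspace A -> A p -> A (c *: p).
Proof. by move=> [A0 AP] Ap; rewrite -(addr0 (c *: p)); apply: AP. Qed.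

Lemma subspaceB (K : fieldType) (n : nat) (A : set {mpoly K[n]}) p q :
  is_subspace A -> A p -> A q -> A (p - q).
Proof.
by move=> sA Ap Aq; apply: subspaceD => //; rewrite -scaleN1r; apply: subspaceZ.
Qed.

Lemma subspace_subKr (K : fieldType) (n : nat) (A : set {mpoly K[n]}) p q :
  is_subspace A -> A (p - q) -> A q -> A p.
Proof. by move=> sA Apq Aq; rewrite -(subrK q p); apply: subspaceD. Qed.

Lemma subspace_sum (K : fieldType) (n : nat) (A : set {mpoly K[n]})
    (I : Type) (r : seq I) (P : pred I) (f : I -> {mpoly K[n]}) :
  is_subspace A -> (forall i, P i -> A (f i)) -> A (\sum_(i <- r | P i) f i).
Proof.
move=> sA Af; apply: big_ind => //; first by case: sA.
by move=> p q; apply: subspaceD.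
Qed.

(** Polynomials are handled below one variable at a time, which keeps each
    degree constraint at a single increment; this induction passes from
    variables to monomials. *)
Lemma mnm_ind (n : nat) (P : 'X_{1..n} -> Prop) :
  P 0%MM -> (forall i m, P m -> P (m + U_(i))%MM) -> forall m, P m.
Proof.
move=> P0 PS m; have [k] := ubnP (mdeg m); elim: k m => // k IH m.
have [-> //|m0] := eqVneq m 0%MM.
have [i mi] : exists i, m i != 0%N.
  apply/existsP; apply: contra_neqT m0; rewrite negb_exists => /forallP m0.
  by apply/mnmP => i; rewrite mnm0E; apply/eqP; rewrite -[_ == _]negbK.
have U_m : (U_(i) <= m)%MM by rewrite lep1mP.
rewrite -(submK U_m) mdegD mdeg1 addn1 ltnS => lt_k.
exact/PS/IH.
Qed.

Lemma ideal_from_Xi (K : fieldType) (n : nat) (A : set {mpoly K[n]}) :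
  is_subspace A -> (forall i p, A p -> A ('X_i * p)) -> is_ideal A.
Proof.
move=> sA AX; split=> [|p q|h p Ap]; [by case: sA | exact: subspaceD |].
rewrite [h]mpolyE mulr_suml; apply: subspace_sum => // m _.
rewrite -scalerAl; apply: subspaceZ => //.
elim/mnm_ind: m => [|i m IH]; first by rewrite mpolyX0 mul1r.
by rewrite mpolyXD -mulrA mulrCA; apply: AX.
Qed.

Lemma subspace_mulXi (K : fieldType) (n D : nat) (V : set {mpoly K[n]})
    (i : 'I_n) (p : {mpoly K[n]}) :
  monomial_closed_upto (D%:Z)%:E V -> V p -> (msize p <= D)%N -> V ('X_i * p).
Proof.
move=> cV Vp pD; apply: cV => //.
by rewrite deg_leE (leq_trans (msize_mulXi _ _)).
Qed.

(** * Extending a truncated subspace to an ideal *)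

(** The variable [i] to strip from [m] is a fixed choice among those that divide
    [m]; [k] is fuel, meant to be the degree of [m]. *)
Fixpoint mnm_rec (n : nat) (A : Type) (a : A) (step : 'I_n -> A -> A) (k : nat)
    (m : 'X_{1..n}) : A :=
  if k is k'.+1 then
    if [pick i | m i != 0%N] is Some i
    then step i (mnm_rec a step k' (m - U_(i))%MM) else a
  else a.

(** Hides how the variable is chosen: all that matters is that some variable
    dividing [m] was used for the last step. *)
Lemma mnm_recP (n : nat) (A : Type) (a : A) (step : 'I_n -> A -> A) :
  exists phi : 'X_{1..n} -> A, phi 0%MM = a /\
    forall m, m != 0%MM ->
      exists i m', m = (m' + U_(i))%MM /\ phi m = step i (phi m').
Proof.
exists (fun m => mnm_rec a step (mdeg m) m); split=> [|m m0]; first by rewrite mdeg0.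
have: mdeg m != 0%N by rewrite mdeg_eq0.
case E: (mdeg m) => [//|k] _ /=; case: pickP => [i mi|no]; last first.
  case/eqP: m0; apply/mnmP => i; rewrite mnm0E; apply/eqP.
  by have /negbFE := no i.
have U_m : (U_(i) <= m)%MM by rewrite lep1mP.
exists i, (m - U_(i))%MM; rewrite submK //; split=> //.
suff -> : mdeg (m - U_(i))%MM = k by [].
by apply/eqP; rewrite -(eqn_add2r 1) -{1}(mdeg1 i) -mdegD submK // E addn1.
Qed.

(** The linear extension to all polynomials of a map given on monomials. *)
Definition mnm_extend (K : fieldType) (n : nat)
    (phi : 'X_{1..n} -> {mpoly K[n]}) (p : {mpoly K[n]}) : {mpoly K[n]} :=
  \sum_(m <- msupp p) p@_m *: phi m.

(** Summing over a support-independent index set makes linearity immediate. *)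
Lemma mnm_extendE (K : fieldType) (n k : nat)
    (phi : 'X_{1..n} -> {mpoly K[n]}) (p : {mpoly K[n]}) :
  (msize p <= k)%N ->
  mnm_extend phi p = \sum_(m : 'X_{1..n < k}) p@_m *: phi m.
Proof.
move=> pk; pose I : subFinType _ := 'X_{1..n < k}.
rewrite /mnm_extend (big_mksub I) ?msupp_uniq //=; last first.
  by move=> m /msize_mdeg_lt /leq_trans; apply.
by rewrite big_rmcond //= => m /memN_msupp_eq0 ->; rewrite scale0r.
Qed.

Lemma mnm_extendP (K : fieldType) (n : nat)
    (phi : 'X_{1..n} -> {mpoly K[n]}) (c : K) (p q : {mpoly K[n]}) :
  mnm_extend phi (c *: p + q) = c *: mnm_extend phi p + mnm_extend phi q.
Proof.
set k := maxn (msize p) (msize q).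
have pk : (msize p <= k)%N by apply: leq_maxl.
have qk : (msize q <= k)%N by apply: leq_maxr.
have cpqk : (msize (c *: p + q) <= k)%N.
  by rewrite msizeD_leq // (leq_trans (msizeZ_le _ _)).
rewrite (mnm_extendE _ pk) (mnm_extendE _ qk) (mnm_extendE _ cpqk).
rewrite scaler_sumr -big_split; apply: eq_bigr => m _ /=.
by rewrite linearP /= scalerDl scalerA.
Qed.

Lemma mnm_extend_mulXi (K : fieldType) (n : nat)
    (phi : 'X_{1..n} -> {mpoly K[n]}) (i : 'I_n) (p : {mpoly K[n]}) :
  mnm_extend phi ('X_i * p) = \sum_(m <- msupp p) p@_m *: phi (m + U_(i))%MM.
Proof.
rewrite /mnm_extend mulrC (perm_big _ (msuppMX p U_(i))) /= big_map.
by apply: eq_bigr => m _; rewrite mcoeffMX addmC.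
Qed.

(** Let [phi m] represent the action of the monomial [m] on the class of 1, in
    the module structure on polynomials of degree less than [r] modulo [V].
    Then [I] consists of the [p] whose linear extension [Phi p] lies in [V]. The
    representatives are computed by stripping variables in an arbitrary order,
    so all rests on [phiX]: multiplying by any variable [j], and not just by the
    one used to define [phi], is compatible with [phi] modulo [V]. When [r = 0]
    every representative is 0, and [V] contains all polynomials of degree at
    most [D]. *)
Lemma ideal_agreeing (K : fieldType) (n r D : nat) (V : set {mpoly K[n]}) :
  (r < D)%N -> is_subspace V -> monomial_closed_upto (D%:Z)%:E V ->
  (forall p, (msize p <= r.+1)%N -> exists2 s, (msize s <= r)%N & V (p - s)) ->
  exists I, is_ideal I /\ forall p, (msize p <= D.+1)%N -> I p <-> V p.
Proof.
move=> rD sV cV exs.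
have VX i p : (msize p <= D)%N -> V p -> V ('X_i * p).
  by move=> pD Vp; apply: subspace_mulXi Vp pD.
have /boolp.choice[red redP] p : exists s, (msize p <= r.+1)%N ->
    (msize s <= r)%N /\ V (p - s).
  have [/exs[s sr Vs]|pr] := boolP (msize p <= r.+1)%N; first by exists s.
  by exists 0.
have [phi [phi0 phiS]] := mnm_recP (red 1) (fun i s => red ('X_i * s)).
have phi_r m : (msize (phi m) <= r)%N.
  have [k] := ubnP (mdeg m); elim: k m => // k IH m mk.
  have [->|/phiS[i [m' [em ->]]]] := eqVneq m 0%MM.
    by rewrite phi0; case: (redP 1); rewrite ?msize1.
  apply: (redP _ _).1; rewrite (leq_trans (msize_mulXi _ _)) // ltnS IH //.
  by move: mk; rewrite em mdegD mdeg1 addn1.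
have phi_step m : m != 0%MM -> exists i m',
    m = (m' + U_(i))%MM /\ V ('X_i * phi m' - phi m).
  move=> /phiS[i [m' [em ->]]]; exists i, m'; split=> //; apply: (redP _ _).2.
  by rewrite (leq_trans (msize_mulXi _ _)) ?ltnS ?phi_r.
have r_ltD p : (msize p <= r)%N -> (msize p <= D)%N.
  by move=> /leq_trans; apply; apply: ltnW.
have Xphi_D i m : (msize ('X_i * phi m) <= D)%N.
  by rewrite (leq_trans (msize_mulXi _ _)) // (leq_trans _ rD) // ltnS.
(* If the last step to m + U_j used i <> j, then m = m' + U_i, and the inductive
   hypothesis at m' for j and for i lets the two variables be exchanged. The
   congruences it gives hold between polynomials of degree at most r < D, so
   they can be multiplied by one more variable inside V. *)
have phiX m j : V ('X_j * phi m - phi (m + U_(j))%MM).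
  have [k] := ubnP (mdeg m); elim: k m j => // k IH m j mk.
  have /phi_step[i [m1 [em Vm]]] : (m + U_(j))%MM != 0%MM.
    by rewrite mnmD_eq0 mnm1_eq0 andbF.
  have [eij|nij] := eqVneq i j.
    move: em Vm; rewrite eij => em; suff -> : m1 = m by [].
    by rewrite -[m1](addmK U_(j)%MM) -em addmK.
  have U_m : (U_(i) <= m)%MM.
    rewrite lep1mP; have /mnmP/(_ i) := em; rewrite !mnmDE !mnm1E eqxx.
    by rewrite (eq_sym j) (negbTE nij) addn0 addn1 => ->.
  move: (submK U_m); move: (m - U_(i))%MM => m' em'.
  have em1 : m1 = (m' + U_(j))%MM.
    by rewrite -[m1](addmK U_(i)%MM) -em -em' -addmA (addmC U_(i)%MM) addmA addmK.
  have m'k : (mdeg m' < k)%N by move: mk; rewrite -em' mdegD mdeg1 addn1.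
  have V1 : V ('X_i * ('X_j * phi m' - phi m1)).
    rewrite em1; apply: VX (IH _ _ m'k).
    by rewrite msizeB_leq ?Xphi_D ?r_ltD.
  have V2 : V ('X_j * ('X_i * phi m' - phi m)).
    rewrite -em'; apply: VX (IH _ _ m'k).
    by rewrite msizeB_leq ?Xphi_D ?r_ltD.
  have := subspaceD sV (subspaceB sV V1 V2) Vm.
  by congr V; ring.
pose Phi := mnm_extend phi.
have Phi_r p : (msize (Phi p) <= r)%N.
  apply: (big_ind (fun q => msize q <= r)%N) => [||m _]; first by rewrite mmeasure0.
    exact: msizeD_leq.
  by rewrite (leq_trans (msizeZ_le _ _)).
(* Each variable of m multiplies a difference of degree below D, so V stays
   closed along the way and representatives are congruent to their monomials. *)
have phi_eq m : (mdeg m <= D)%N -> V ('X_[m] - phi m).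
  have [k] := ubnP (mdeg m); elim: k m => // k IH m mk mD.
  have [->|/phi_step[i [m' [em Vm]]]] := eqVneq m 0%MM.
    by rewrite phi0 mpolyX0; apply: (redP _ _).2; rewrite msize1.
  have em' : mdeg m = (mdeg m').+1 by rewrite em mdegD mdeg1 addn1.
  have Vm' : V ('X_i * ('X_[m'] - phi m')).
    apply: VX; first by rewrite msizeB_leq ?msizeX -?em' ?r_ltD.
    by apply: IH; rewrite -?em' // ltnW // -em'.
  have := subspaceD sV Vm' Vm; congr V.
  by rewrite mulrBr -mpolyXD addmC -em addrA subrK.
have Phi_eq p : (msize p <= D.+1)%N -> V (p - Phi p).
  move=> pD; rewrite {1}[p]mpolyE /Phi /mnm_extend -sumrB big_seq.
  apply: subspace_sum => // m mp; rewrite -scalerBr; apply: subspaceZ => //.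
  by apply: phi_eq; rewrite -ltnS (leq_trans (msize_mdeg_lt mp)).
exists (fun p => V (Phi p)); split; last first.
  move=> p pD; split=> [|Vp]; first exact: (subspace_subKr sV (Phi_eq _ pD)).
  by rewrite -(subKr p (Phi p)); apply: (subspaceB sV Vp); apply: Phi_eq.
apply: ideal_from_Xi => [|i p Vp].
  split=> [|c p q Vp Vq]; first by rewrite /Phi /mnm_extend msupp0 big_nil; case: sV.
  by rewrite /Phi mnm_extendP; apply: sV.2.
rewrite -(subKr ('X_i * Phi p) (Phi _)); apply: (subspaceB sV).
  by apply: VX => //; apply: r_ltD.
rewrite /Phi mnm_extend_mulXi /mnm_extend mulr_sumr -sumrB.
apply: subspace_sum => // m _; rewrite -scalerAr -scalerBr.
exact: subspaceZ.
Qed.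

(** * The subspaces of the last fall degree *)

Lemma Vspace_subspace (K : fieldType) (n d : nat) (F : seq {mpoly K[n]}) :
  is_subspace (Vspace F (d%:Z)%:E).
Proof.
rewrite /Vspace /=; split=> [|c p q Vp Vq] A [[sA cA] FA]; first by case: sA.
by apply: sA.2; [apply: Vp | apply: Vq]; split.
Qed.

Lemma Vspace_closed (K : fieldType) (n d : nat) (F : seq {mpoly K[n]}) :
  monomial_closed_upto (d%:Z)%:E (Vspace F (d%:Z)%:E).
Proof.
rewrite /Vspace /= => m f Vf md A [[sA cA] FA].
by apply: (cA _ _ _ md); apply: Vf; split.
Qed.

Lemma Vspace_gen (K : fieldType) (n d : nat) (F : seq {mpoly K[n]}) f :
  f \in F -> (msize f <= d.+1)%N -> Vspace F (d%:Z)%:E f.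
Proof.
rewrite /Vspace /= => fF fd A [_]; apply.
by split=> //; rewrite deg_leE.
Qed.

(** Lifting from top forms to generators: replace each top form by its generator
    in a combination that expresses [q]. To avoid handling combinations, observe
    that the [q] with the stated property in all degrees [d <= e] form an ideal
    containing the top forms. Asking for the bound [d] on the degree of [v],
    rather than [e], is what makes the property stable under multiplication by a
    variable. *)
Lemma top_ideal_Vspace (K : fieldType) (n e : nat) (F : seq {mpoly K[n]})
    (q : {mpoly K[n]}) (d : nat) :
  ideal_gen [set` [seq top_form f | f <- F]] q -> (d <= e)%N ->
  exists v, [/\ Vspace F (e%:Z)%:E v, (msize v <= d.+1)%N
              & pihomog mdeg d v = pihomog mdeg d q].
Proof.
set V := Vspace _ _; have sV : is_subspace V := Vspace_subspace e F.
have cV : monomial_closed_upto (e%:Z)%:E V := @Vspace_closed _ _ e F.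
pose B q := forall d, (d <= e)%N -> exists v,
  [/\ V v, (msize v <= d.+1)%N & pihomog mdeg d v = pihomog mdeg d q].
move=> Iq de; suff: B q by apply.
move: q Iq {d de}; apply: smallest_sub.
  apply: ideal_from_Xi; first split=> [d de|c p q Bp Bq d de].
  - by exists 0; rewrite mmeasure0; split=> //; case: sV.
  - have [v [Vv vd vp]] := Bp d de; have [w [Vw wd wq]] := Bq d de.
    exists (c *: v + w); split; first exact: sV.2.
      by rewrite msizeD_leq // (leq_trans (msizeZ_le _ _)).
    by rewrite !linearP /= vp wq.
  move=> i p Bp [|d] de.
    by exists 0; rewrite mmeasure0 pihomog0 pihomog0_mulXi; split=> //; case: sV.
  have [v [Vv vd vp]] := Bp d (ltnW de); exists ('X_i * v).
  rewrite !pihomog_mulXi vp; split=> //.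
    by apply: subspace_mulXi cV Vv _; apply: leq_trans vd _.
  by rewrite (leq_trans (msize_mulXi _ _)).
move=> _ /= /mapP[f fF ->] d de; rewrite /top_form.
have [ed|df] := eqVneq d (msize f).-1; last first.
  exists 0; rewrite mmeasure0; split=> //; first by case: sV.
  by rewrite pihomog0 (@pihomog_ne0 _ _ _ (msize f).-1) ?pihomogP // eq_sym.
exists f; rewrite ed pihomog_id leqSpred; split=> //; apply: Vspace_gen fF _.
by apply: leq_trans (leqSpred _) _; rewrite ltnS -ed.
Qed.

Lemma regular_reduction (K : fieldType) (n r e : nat) (F : seq {mpoly K[n]})
    (p : {mpoly K[n]}) :
  homog_part (ideal_gen [set` [seq top_form f | f <- F]]) r
    = homog_part [set: {mpoly K[n]}] r ->
  (r <= e)%N -> (msize p <= r.+1)%N ->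
  exists2 s, (msize s <= r)%N & Vspace F (e%:Z)%:E (p - s).
Proof.
move=> reg re pr.
have [Ip _] : homog_part (ideal_gen [set` [seq top_form f | f <- F]]) r
    (pihomog mdeg r p).
  by rewrite reg; split=> //; apply: pihomogP.
have [v [Vv vr vp]] := top_ideal_Vspace Ip re.
exists (p - v); last by rewrite subKr.
apply: msize_pihomog0; first exact: msizeB_leq.
by rewrite pihomogB vp pihomog_id subrr.
Qed.

Lemma ideal_gen_Vspace (K : fieldType) (n r e : nat) (F : seq {mpoly K[n]})
    (f : {mpoly K[n]}) :
  homog_part (ideal_gen [set` [seq top_form f | f <- F]]) r
    = homog_part [set: {mpoly K[n]}] r ->
  (r < e)%N -> {in F, forall g, (msize g <= e.+1)%N} -> (msize f <= e.+1)%N ->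
  ideal_gen [set` F] f -> Vspace F (e%:Z)%:E f.
Proof.
move=> reg re Fe fe If.
have [I [idI IV]] := ideal_agreeing re (Vspace_subspace e F) (@Vspace_closed _ _ e F)
  (fun p => regular_reduction reg (ltnW re)).
apply/(IV _ fe); apply: If; split=> // g /= gF.
by apply/IV; [apply: Fe | apply: Vspace_gen gF (Fe _ gF)].
Qed.

(** Degrees are either natural numbers or -oo, and a maximum with a natural
    number absorbs -oo; so the bounds at hand are finite, which selects the
    linear-algebra case in the definition of [Vspace]. *)
Lemma maxe_deg_nat (K : fieldType) (n d : nat) (F : seq {mpoly K[n]}) :
  exists e : nat, maxe (d%:Z)%:E (\big[maxe/-oo]_(f <- F) deg f)%E = (e%:Z)%:E.
Proof.
elim: F d => [|f F IH] d; first by exists d; rewrite big_nil maxeNy.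
rewrite big_cons maxA; suff [k ->] : exists k : nat,
  maxe (d%:Z)%:E (deg f) = (k%:Z)%:E by apply: IH.
rewrite /deg; case: eqP => _; first by exists d; rewrite maxeNy.
by case: leP => _; [exists (msize f).-1 | exists d].
Qed.

Theorem corollary3p11 (K : fieldType) (n : nat) (F : seq {mpoly K[n]}) :
  (Lfd F <= maxe (dreg F + 1%:E) (\big[maxe/-oo]_(f <- F) deg f))%E.
Proof.
rewrite {1}/dreg /min_or_pinfty; case: pselect => [exr|_]; last first.
  by rewrite addye // maxye leey.
case: ex_minnP => r /asboolP reg _.
have -> : ((r%:Z)%:E + 1%:E = (r.+1%:Z)%:E)%E by rewrite -EFinD -addn1 PoszD.
have [D eD] := maxe_deg_nat r.+1 F; rewrite eD.
have rD : (r < D)%N by rewrite -lez_nat -lee_fin -eD le_max lexx.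
have FD g : g \in F -> (msize g <= D.+1)%N.
  move=> gF; rewrite -deg_leE -eD le_max; apply/orP; right.
  elim: F gF {reg eD exr} => // h F IH; rewrite in_cons big_cons le_max.
  by case/predU1P => [-> | /IH ->]; rewrite ?lexx ?orbT.
apply: Lfd_min; split=> [|f If]; first by rewrite lte_fin ltz_nat (leq_trans _ rD).
have [e ee] : exists e : nat, maxe (D%:Z)%:E (deg f) = (e%:Z)%:E.
  by have := maxe_deg_nat D [:: f]; rewrite big_seq1.
have De : (D <= e)%N by rewrite -lez_nat -lee_fin -ee le_max lexx.
rewrite ee; apply: ideal_gen_Vspace reg _ _ _ If; first exact: leq_trans De.
  by move=> g /FD /leq_trans; apply; rewrite ltnS.
by rewrite -deg_leE -ee le_max lexx orbT.
Qed.
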